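(* Let $\{e_j\}_{j\in\mathbb{N}_0}$ be unit vectors in a Hilbert space $\mathscr{H}$, let $P_j=|e_j\rangle\langle e_j|$, and assume that the system $\{|e_j\rangle\langle e_j|\}_{j\in\mathbb{N}_0}$ is effective. Set $Q_0=P_0$, $Q_n=P_n(1-P_{n-1})\cdots(1-P_0)$ for $n\ge1$, and let $g_j\in\mathscr{H}$ be the unique vector with $Q_j=|e_j\rangle\langle g_j|$. Then, for all $x\in\mathscr{H}$, $$x=\sum_{j\in\mathbb{N}_0}\langle g_j,x\rangle e_j.$$ In particular, for all bounded operators $A\in\mathscr{B}(\mathscr{H})$ and all $x\in\mathscr{H}$, $$Ax=\sum_{j\in\mathbb{N}_0}\langle A^*g_j,x\rangle e_j.$$ Moreover, for all $x,y\in\mathscr{H}$, $$\langle x,y\rangle=\sum_{j\in\mathbb{N}_0}\langle x,g_j\rangle\langle g_j,y\rangle\qquad\text{and}\qquad\|x\|^2=\sum_{j\in\mathbb{N}_0}|\langle g_j,x\rangle|^2.$$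
   Context: $\mathbb{N}_0=\{0,1,2,\dots\}$. The inner product is linear in the second variable. For $u,v\in\mathscr{H}$, $|u\rangle\langle v|$ is the operator $x\mapsto\langle v,x\rangle u$; $1$ denotes the identity operator. A system $\{P_j\}_{j\in\mathbb{N}_0}$ of selfadjoint projections is called effective if $T_n:=(1-P_n)(1-P_{n-1})\cdots(1-P_0)\to0$ in the strong operator topology, i.e. $\lim_n\|T_nx\|=0$ for every $x\in\mathscr{H}$. Each $Q_j$ has range in the span of $e_j$, so $g_j$ exists and is unique. Infinite sums are limits of the partial sums $\sum_{j=0}^n$ (in norm for vector-valued sums). *)

(* Defs.v *)
From HB Require Import structures.
From mathcomp Require Import all_boot all_order all_algebra.
From mathcomp Require Import all_classical all_reals all_analysis.
From mathcomp Require Import complex.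

Set Implicit Arguments.
Unset Strict Implicit.
Unset Printing Implicit Defensive.

Import Order.TTheory GRing.Theory Num.Theory.
Import numFieldNormedType.Exports.

Local Open Scope classical_set_scope.
Local Open Scope ring_scope.

(* Complex Hilbert spaces: the forms [{dot H for Num.conj}] of MathComp are
   positive definite, linear in the FIRST variable and conjugate-linear in the
   second one.  Norms take their values in [R[i]]. *)
HB.mixin Record CompleteNormedModule_isHilbert (R : realType) H
    & CompleteNormedModule R[i] H := {
  dotform : {dot H for (@Num.conj R[i])} ;
  sqr_norm_dotform : forall x : H, `|x| ^+ 2 = dotform x x
}.

#[short(type="hilbertType")]
HB.structure Definition Hilbert (R : realType) :=
  {H of CompleteNormedModule R[i] H & CompleteNormedModule_isHilbert R H}.

Section operators.
Context {R : realType} {H : hilbertType R}.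

(* Linear in the SECOND variable, hence the swap. *)
Definition inner (u v : H) : R[i] := @dotform R H v u.

Definition ketbra (u v : H) : H -> H := fun x => inner v x *: u.

Definition bounded_operator (A : {linear H -> H}) : Prop :=
  exists M : R[i], forall x, `|A x| <= M * `|x|.

(* [get] picks the vector given by the Riesz representation theorem; it is
   unique since the inner product is nondegenerate. *)
Definition adjoint (A : H -> H) (y : H) : H :=
  get [set z | forall x, inner z x = inner y (A x)].

(* [residual P n] is the operator (1 - P_n) (1 - P_(n-1)) ... (1 - P_0). *)
Fixpoint residual (P : nat -> H -> H) (n : nat) : H -> H :=
  match n with
  | 0 => id \- P 0
  | m.+1 => (id \- P m.+1) \o residual P m
  end.

Definition effective (P : nat -> H -> H) : Prop :=
  forall x, residual P n x @[n --> \oo] --> (0 : H).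

Definition increment (P : nat -> H -> H) (n : nat) : H -> H :=
  match n with
  | 0 => P 0
  | m.+1 => P m.+1 \o residual P m
  end.

End operators.

(* Main.v *)
Require Import Defs.
From HB Require Import structures.
From mathcomp Require Import all_boot all_order all_algebra.
From mathcomp Require Import all_classical all_reals all_analysis.
From mathcomp Require Import complex ring.

Set Implicit Arguments.
Unset Strict Implicit.
Unset Printing Implicit Defensive.

Import Order.TTheory GRing.Theory Num.Theory.
Import numFieldNormedType.Exports.

Local Open Scope classical_set_scope.
Local Open Scope ring_scope.

(** Since [(1 - P_(n-1)) ... (1 - P_0)] minus [(1 - P_n) ... (1 - P_0)] is
[Q_n], the sum [Q_0 + ... + Q_n] telescopes to [1 - T_n]; effectiveness says
[T_n x --> 0], which is the reconstruction formula.  Applying Pythagoras at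
each step, the range of [P_n] being orthogonal to that of [1 - P_n], gives the
polarised identity
[<x, y> = \sum_(j <= n) <Q_j x, Q_j y> + <T_n x, T_n y>]
([increment_pythagoras]).  As [e_j] is a unit vector,
[<Q_j x, Q_j y> = <x, g_j> <g_j, y>], and the remainder tends to [0] by
Cauchy-Schwarz: [g] is a Parseval frame.

The formula for [A x] is reconstruction applied to [A x], once one knows that
the adjoint of a bounded operator satisfies [<A^* y, z> = <y, A z>], i.e. that
the functional [z |-> <y, A z>] is represented by a vector.  The Parseval frame
itself provides the Riesz representation ([Riesz_of_parseval]): the vector
representing [f] is [\sum_j (f g_j)^* g_j].  This series converges because the
synthesis map [c |-> \sum_j c_j g_j] is a contraction on square-summable
families ([synthesis_le], [synthesis_cvg]), and it represents [f] because
[x = \sum_j <g_j, x> g_j] in norm and [f] is continuous. *)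

(** * Inner products *)

Section inner_product.
Context {R : realType} {H : hilbertType R}.
Implicit Types (u v w : H) (a : R[i]).

Lemma innerDr u v w : inner u (v + w) = inner u v + inner u w.
Proof. exact: linearDl. Qed.

Lemma innerBr u v w : inner u (v - w) = inner u v - inner u w.
Proof. exact: linearBl. Qed.

Lemma innerZr u a v : inner u (a *: v) = a * inner u v.
Proof. exact: linearZl_LR. Qed.

Lemma inner_sumr u (I : Type) (r : seq I) (P : pred I) (E : I -> H) :
  inner u (\sum_(i <- r | P i) E i) = \sum_(i <- r | P i) inner u (E i).
Proof. exact: linear_sumlz. Qed.

Lemma innerBl u v w : inner (v - w) u = inner v u - inner w u.
Proof. exact: linearBr. Qed.

Lemma innerZl u a v : inner (a *: v) u = a^* * inner v u.
Proof. exact: linearZr_LR. Qed.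

Lemma inner_suml u (I : Type) (r : seq I) (P : pred I) (E : I -> H) :
  inner (\sum_(i <- r | P i) E i) u = \sum_(i <- r | P i) inner (E i) u.
Proof. exact: linear_sumr. Qed.

Lemma inner_conj u v : inner u v = (inner v u)^*.
Proof. by rewrite /inner hermC expr0 mul1r. Qed.

Lemma inner_is_linear u : linear (inner u : H -> R[i]^o).
Proof. by move=> a v w; rewrite innerDr innerZr. Qed.

HB.instance Definition _ u :=
  GRing.isLinear.Build R[i] H R[i]^o _ (inner u) (inner_is_linear u).

Lemma inner_normE u : inner u u = `|u| ^+ 2.
Proof. by rewrite sqr_norm_dotform. Qed.

Lemma inner_normM u v : inner u v * inner v u = `|inner v u| ^+ 2.
Proof. by rewrite normCK mulrC -inner_conj. Qed.

Lemma inner_ext u v : (forall w, inner u w = inner v w) -> u = v.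
Proof.
move=> uv; apply/eqP; rewrite -subr_eq0 -normr_eq0 -sqrf_eq0 -inner_normE.
by rewrite innerBl uv subrr.
Qed.

(** The norm of [|u|^2 v - <u, v> u], which is [|u|^2] times the component of
    [v] orthogonal to [u], is nonnegative. *)
Lemma Cauchy_Schwarz u v : `|inner u v| <= `|u| * `|v|.
Proof.
have [->|u0] := eqVneq u 0.
  by rewrite /inner linear0r !normr0 mul0r.
have nu : 0 < `|u| by rewrite normr_gt0.
have : 0 <= `| (`|u| ^+ 2) *: v - inner u v *: u| ^+ 2 by rewrite exprn_ge0.
rewrite -[X in 0 <= X]inner_normE innerBl !innerBr !innerZl !innerZr !inner_normE.
rewrite -[(inner u v)^*]inner_conj.
have -> : (`|u| ^+ 2)^* = `|u| ^+ 2 by apply: geC0_conj; rewrite exprn_ge0.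
set t := (X in 0 <= X); have {t}-> : t =
    `|u| ^+ 2 * ((`|u| * `|v|) ^+ 2 - inner v u * inner u v) by rewrite /t; ring.
rewrite inner_normM pmulr_rge0 ?exprn_gt0// subr_ge0 ler_sqr//.
by rewrite nnegrE mulr_ge0.
Qed.

End inner_product.

(** * Convergence of sequences *)

Section squeeze.
Context {K : numFieldType} {V : normedModType K}.

(** A squeeze principle over a field such as [R[i]], whose order is only
    partial: bounds on norms are real, hence comparable. *)
Lemma cvg_squeeze_dist (f : nat -> V) (l : V) (b : nat -> K^o) :
  (forall n, `|f n - l| <= b n) -> b @ \oo --> (0 : K^o) -> f @ \oo --> l.
Proof.
move=> fb b0; apply/cvgrPdist_lt => eps eps0.
move/cvgr0Pnorm_lt : b0 => /(_ eps eps0); apply: filterS => n bn.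
rewrite distrC; apply: le_lt_trans (fb n) (le_lt_trans _ bn).
by rewrite ger0_norm// (le_trans _ (fb n)).
Qed.

Lemma cvg_dist0 (f : nat -> V) (l : V) :
  f @ \oo --> l -> (fun n => `|f n - l| : K^o) @ \oo --> (0 : K^o).
Proof. by move=> fl; apply/norm_cvg0P/subr_cvg0. Qed.

Lemma cvg_seq_unique (f : nat -> V) (a b : V) :
  f @ \oo --> a -> f @ \oo --> b -> a = b.
Proof. exact: cvg_unique. Qed.

End squeeze.

Section limits.
Context {R : realType} {H : hilbertType R}.

Lemma bounded_linear_cvg (K : normedModType R[i]) (f : {linear H -> K}) (M : R[i])
    (fM : forall x, `|f x| <= M * `|x|) (u : nat -> H) (x : H) :
  u @ \oo --> x -> (f \o u) @ \oo --> f x.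
Proof.
move=> /cvg_dist0 ux; apply: (@cvg_squeeze_dist _ K _ _ (fun n => M * `|u n - x|)).
  by move=> n /=; rewrite -linearB.
by rewrite -(mulr0 M); exact: cvgMl_tmp ux.
Qed.

Lemma inner_cvgl (u : nat -> H) (x y : H) :
  u @ \oo --> x -> (fun n => inner (u n) y : R[i]^o) @ \oo --> (inner x y : R[i]^o).
Proof.
move=> /cvg_dist0 ux.
apply: (@cvg_squeeze_dist R[i] R[i]^o _ _ (fun n => `|u n - x| * `|y|)).
  by move=> n; rewrite -innerBl; exact: Cauchy_Schwarz.
by rewrite -(mul0r `|y|); exact: cvgMr_tmp ux.
Qed.

End limits.

Section bounded_series.
Context {R : realType}.

(** Nonnegative elements of [R[i]] are real, so this is the convergence of
    bounded monotone sequences of [R], transported through the embedding. *)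
Lemma bounded_series_cauchy (a : nat -> R[i]) (B : R[i]) :
    (forall n, 0 <= a n) -> (forall n, \sum_(0 <= k < n) a k <= B) ->
  forall eps : R[i], 0 < eps ->
  \forall n \near (\oo, \oo), `|\sum_(n.1 <= k < n.2) a k| < eps.
Proof.
move=> a0 aB eps eps0.
have aE k : a k = (complex.Re (a k))%:C%C by rewrite RRe_real// ger0_real.
have sumE m n : \sum_(m <= k < n) a k = (\sum_(m <= k < n) complex.Re (a k))%:C%C.
  by rewrite rmorph_sum/=; apply: eq_bigr => k _; rewrite -aE.
have ra0 k : 0 <= complex.Re (a k) by rewrite -lecR -aE.
have Breal : B = (complex.Re B)%:C%C.
  by rewrite RRe_real// ger0_real//; move: (aB 0); rewrite big_geq.
have epsE : eps = (complex.Re eps)%:C%C by rewrite RRe_real// gtr0_real.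
have : cvgn (series (fun k => complex.Re (a k))).
  apply: nondecreasing_is_cvgn.
    apply/nondecreasing_seqP => n.
    by rewrite seriesSr lerDl.
  by exists (complex.Re B) => _ [n _ <-]; rewrite -lecR -Breal /series/= -sumE.
move/cvg_cauchy/cauchy_seriesP => /(_ (complex.Re eps)).
rewrite -ltcR -epsE => /(_ eps0); apply: filterS => n.
by rewrite sumE epsE normc_def /= expr0n addr0 sqrtr_sqr ltcR.
Qed.

End bounded_series.

(** * Telescoping and Pythagoras *)

Section telescoping.
Context {R : realType} {H : hilbertType R}.

Lemma sum_increment (P : nat -> H -> H) (x : H) n :
  \sum_(0 <= j < n.+1) increment P j x = x - residual P n x.
Proof.
elim: n => [|n IH]; first by rewrite big_nat1 /= opprB addrC subrK.
by rewrite big_nat_recr//= IH opprB addrA addrAC.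
Qed.

(** [ketbra e e] is the orthogonal projection onto the line of [e]. *)
Lemma ketbra_pythagoras (e x y : H) : `|e| = 1 ->
  inner (ketbra e e x) (ketbra e e y)
  + inner (x - ketbra e e x) (y - ketbra e e y) = inner x y.
Proof.
move=> e1; have ee : inner e e = 1 by rewrite inner_normE e1 expr1n.
rewrite /ketbra innerBl !innerBr !innerZl !innerZr ee -inner_conj.
by ring.
Qed.

(** Each step splits the current residual orthogonally into the next
    increment and the next residual. *)
Lemma increment_pythagoras (e : nat -> H) (P := fun k => ketbra (e k) (e k))
    (x y : H) n : (forall j, `|e j| = 1) ->
  \sum_(0 <= j < n.+1) inner (increment P j x) (increment P j y)
  + inner (residual P n x) (residual P n y) = inner x y.
Proof.
move=> e1; elim: n => [|n IH].
  by rewrite big_nat1; exact: ketbra_pythagoras.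
by rewrite big_nat_recr//= -addrA ketbra_pythagoras.
Qed.

End telescoping.

(** * Parseval frames and Riesz representation *)

Section parseval_frame.
Context {R : realType} {H : hilbertType R}.
Variable g : nat -> H.
Hypothesis bessel : forall n x,
  \sum_(0 <= j < n) `|inner (g j) x| ^+ 2 <= `|x| ^+ 2.

(** With [v] the synthesised vector, [|v|^2] equals both
    [\sum_j c_j <v, g_j>] and its conjugate.  Adding them and using
    [c w^* + c^* w <= |c|^2 + |w|^2] termwise, Bessel's inequality gives
    [2 |v|^2 <= \sum_j |c_j|^2 + |v|^2]. *)
Lemma synthesis_le (c : nat -> R[i]) m n :
  `|\sum_(m <= j < n) c j *: g j| ^+ 2 <= \sum_(m <= j < n) `|c j| ^+ 2.
Proof.
set v := \sum_(_ <= _ < _) _.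
have vE : `|v| ^+ 2 = \sum_(m <= j < n) c j * inner v (g j).
  rewrite -inner_normE {2}/v inner_sumr.
  by apply: eq_bigr => j _; rewrite innerZr.
have vE' : `|v| ^+ 2 = \sum_(m <= j < n) (c j)^* * inner (g j) v.
  rewrite -inner_normE {1}/v inner_suml.
  by apply: eq_bigr => j _; rewrite innerZl.
have bes : \sum_(m <= j < n) `|inner (g j) v| ^+ 2 <= `|v| ^+ 2.
  apply: le_trans (bessel n v).
  have [mn|nm] := leqP m n; last by rewrite big_geq ?sumr_ge0// ltnW.
  by rewrite (big_cat_nat (n := m) (m := 0))//= lerDr sumr_ge0.
have : `|v| ^+ 2 + `|v| ^+ 2 <= \sum_(m <= j < n) `|c j| ^+ 2 + `|v| ^+ 2.
  apply: le_trans (lerD (lexx _) bes).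
  rewrite {1}vE vE' -!big_split/=; apply: ler_sum => j _.
  (* the difference of the two sides is a square *)
  rewrite -subr_ge0 (_ : _ - _ = `|c j - inner (g j) v| ^+ 2) ?exprn_ge0//.
  by rewrite !normCK rmorphB/= -[(inner _ _)^*]inner_conj; ring.
by rewrite lerD2r.
Qed.

Lemma synthesis_cvg (c : nat -> R[i]) (B : R[i]) :
    (forall n, \sum_(0 <= j < n) `|c j| ^+ 2 <= B) ->
  exists z : H, series (fun j => c j *: g j) @ \oo --> z.
Proof.
move=> cB; exists (limn (series (fun j => c j *: g j))).
apply/cauchy_cvgP/cauchy_seriesP => eps eps0.
have /bounded_series_cauchy - /(_ _ cB (eps ^+ 2)) : forall j, 0 <= `|c j| ^+ 2.
  by move=> j; rewrite exprn_ge0.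
rewrite exprn_gt0// => /(_ isT); apply: filterS => n.
rewrite ger0_norm; last by apply: sumr_ge0 => j _; rewrite exprn_ge0.
move/(le_lt_trans (synthesis_le c n.1 n.2)).
by rewrite ltr_sqr ?nnegrE// ltW.
Qed.

Hypothesis parseval : forall x y,
  series (fun j => inner x (g j) * inner (g j) y : R[i]^o) @ \oo
    --> (inner x y : R[i]^o).

(** The synthesis bound provides a norm limit, and the weak form of the
    expansion, which is [parseval], identifies it. *)
Lemma parseval_frame_cvg x : series (fun j => inner (g j) x *: g j) @ \oo --> x.
Proof.
have /synthesis_cvg[w cv] := bessel^~ x.
suff wx : w = x by rewrite wx in cv.
apply: inner_ext => y.
apply: (@cvg_seq_unique R[i] R[i]^o _ _ _ (inner_cvgl (y := y) cv)).
rewrite (_ : (fun n => _) =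
    series (fun j => inner x (g j) * inner (g j) y : R[i]^o)) //.
apply/funext => n; rewrite /series/= inner_suml; apply: eq_bigr => j _.
by rewrite innerZl -inner_conj.
Qed.

(** The partial sums [v] of [\sum_j (f g_j)^* g_j] satisfy
    [f v = \sum_j |f g_j|^2 =: a].  Together with [|f v| <= M |v|] and the
    synthesis bound [|v|^2 <= a] this yields [a^2 <= M^2 a], so the
    coefficients are square-summable. *)
Lemma Riesz_of_parseval (f : {linear H -> R[i]^o}) (M : R[i]) :
  (forall x, `|f x| <= M * `|x|) -> exists z, forall x, inner z x = f x.
Proof.
move=> fM; pose c j := (f (g j))^*.
have cM n : \sum_(0 <= j < n) `|c j| ^+ 2 <= `|M| ^+ 2.
  set a := \sum_(_ <= _ < _) _.
  have a0 : 0 <= a by apply: sumr_ge0 => j _; rewrite exprn_ge0.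
  pose v := \sum_(0 <= j < n) c j *: g j.
  have fv : f v = a.
    rewrite linear_sum; apply: eq_bigr => j _.
    by rewrite linearZ/= normCK /c conjCK.
  have [->|a1] := eqVneq a 0; first by rewrite exprn_ge0.
  have {}a1 : 0 < a by rewrite lt_def a1.
  rewrite -(ler_pM2l a1) -expr2.
  apply: (@le_trans _ _ ((`|M| * `|v|) ^+ 2)).
    rewrite ler_sqr ?nnegrE ?mulr_ge0//.
    have MvE : M * `|v| = `|M| * `|v|.
      by rewrite -{2}(normr_id v) -normrM ger0_norm// (le_trans _ (fM v)).
    by rewrite -(ger0_norm a0) -fv -MvE.
  by rewrite exprMn mulrC ler_wpM2r ?exprn_ge0// synthesis_le.
have [z cv] := synthesis_cvg cM; exists z => x.
apply: (@cvg_seq_unique R[i] R[i]^o _ _ _ (inner_cvgl (y := x) cv)).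
rewrite (_ : (fun n => _) = f \o series (fun j => inner (g j) x *: g j)).
  exact: bounded_linear_cvg fM _ _ (parseval_frame_cvg (x := x)).
apply/funext => n; rewrite /series/= inner_suml linear_sum.
by apply: eq_bigr => j _; rewrite innerZl /c conjCK linearZ/= mulrC.
Qed.

End parseval_frame.

(** * Reconstruction and Parseval formulas *)

Theorem corollary3p16 (R : realType) (H : hilbertType R) (e g : nat -> H)
    (e_unit : forall j, `|e j| = 1)
    (e_effective : effective (fun j => ketbra (e j) (e j)))
    (gP : forall j,
      increment (fun k => ketbra (e k) (e k)) j = ketbra (e j) (g j)) :
  (forall x : H, series (fun j => inner (g j) x *: e j) @ \oo --> x)
  /\ (forall A : {linear H -> H}, bounded_operator A ->
      forall x : H,
        series (fun j => inner (adjoint A (g j)) x *: e j) @ \oo --> A x)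
  /\ (forall x y : H,
        series (fun j => inner x (g j) * inner (g j) y : R[i]^o) @ \oo
          --> (inner x y : R[i]^o))
  /\ (forall x : H,
        series (fun j => `|inner (g j) x| ^+ 2 : R[i]^o) @ \oo
          --> (`|x| ^+ 2 : R[i]^o)).
Proof.
set P := fun k => ketbra (e k) (e k) in e_effective gP.
have recon x : series (fun j => inner (g j) x *: e j) @ \oo --> x.
  (* [residual P n] contains the [n.+1] first factors, while [series] at [n]
     stops before the index [n] *)
  rewrite -cvg_shiftS; apply/subr_cvg0.
  rewrite (_ : (fun n => _) = (fun n => - residual P n x)).
    by rewrite -oppr0; apply: cvgN; exact: e_effective.
  apply/funext => n /=; rewrite -[RHS](addrK x) [- _ + x]addrC -sum_increment.
  by congr (_ - _); apply: eq_bigr => j _; rewrite gP.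
have split_inner n x y :
    \sum_(0 <= j < n.+1) inner x (g j) * inner (g j) y
    + inner (residual P n x) (residual P n y) = inner x y.
  rewrite -(increment_pythagoras x y n e_unit); congr (_ + _).
  apply: eq_bigr => j _; rewrite !gP /ketbra innerZl innerZr -inner_conj.
  by rewrite inner_normE e_unit expr1n mulr1.
have parseval x y : series (fun j => inner x (g j) * inner (g j) y : R[i]^o) @ \oo
    --> (inner x y : R[i]^o).
  rewrite -cvg_shiftS.
  apply: (@cvg_squeeze_dist R[i] R[i]^o _ _
            (fun n => `|residual P n x| * `|residual P n y|)).
    move=> n /=; rewrite -(split_inner n x y) opprD addNKr.
    by rewrite normrN Cauchy_Schwarz.
  rewrite -(mulr0 0); apply: cvgM; apply/norm_cvg0P; exact: e_effective.
have bessel n x : \sum_(0 <= j < n) `|inner (g j) x| ^+ 2 <= `|x| ^+ 2.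
  case: n => [|n]; first by rewrite big_geq ?exprn_ge0.
  rewrite -inner_normE -(split_inner n x x) inner_normE.
  under [X in _ <= X + _]eq_bigr do rewrite inner_normM.
  by rewrite lerDl exprn_ge0.
split=> [//|]; split; last first.
  split=> // x; rewrite -inner_normE.
  by under eq_fun do rewrite -inner_normM; exact: parseval.
move=> A [M AM] x.
have adjointP y z : inner (adjoint A y) z = inner y (A z).
  have [w wP] : exists w, forall x, inner w x = (inner y \o A) x.
    apply: (@Riesz_of_parseval _ _ g bessel parseval _ (`|y| * M)) => u /=.
    by rewrite (le_trans (Cauchy_Schwarz _ _))// -mulrA ler_wpM2l.
  by move: z; apply: (@getPex _ [set z | forall x, inner z x = inner y (A x)]); exists w.
by under eq_fun do rewrite adjointP; exact: recon.
Qed.
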